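(* Let $A$ be a semiprime Banach algebra with an identity. If $\mathrm{Soc}(A)$ is closed in $A$ and every nonzero left ideal $I$ of $A$ contains a minimal left ideal, then $A$ is finite dimensional.
   Context: For a Banach algebra $A$, $\mathrm{Soc}(A)$ denotes the left socle of $A$: if $A$ has minimal left ideals, it is the smallest left ideal of $A$ containing all of them (i.e. their sum); if $A$ has no minimal left ideals, $\mathrm{Soc}(A) = (0)$. Semiprime means that the only two-sided ideal $J$ of $A$ with $J^2 = (0)$ is $J = (0)$. Closed means closed in the norm topology. Ideals are not assumed closed unless stated. *)

(* Defs.v *)
From HB Require Import structures.
From mathcomp Require Import all_boot all_order all_algebra.
From mathcomp Require Import all_classical all_reals all_analysis.
From mathcomp Require Import complex.

Set Implicit Arguments.
Unset Strict Implicit.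
Unset Printing Implicit Defensive.

Import Order.TTheory GRing.Theory Num.Theory.
Import numFieldNormedType.Exports.

Local Open Scope classical_set_scope.
Local Open Scope ring_scope.

(* A unital Banach algebra is given as a Banach space with a multiplication,
   because Hierarchy-Builder does not allow a new structure inheriting both a
   ring and a norm (NumDomain already does).  The ring and normed-module
   instances of the carrier are declared below and share their additive group.
   Neither |1| = 1 nor 1 != 0 is imposed. *)
Record banachAlgType (K : numFieldType) := BanachAlg {
  banach_space : completeNormedModType K;
  banach_mul : banach_space -> banach_space -> banach_space;
  banach_one : banach_space;
  banach_mulA : associative banach_mul;
  banach_mul1x : left_id banach_one banach_mul;
  banach_mulx1 : right_id banach_one banach_mul;
  banach_mulDl : left_distributive banach_mul +%R;
  banach_mulDr : right_distributive banach_mul +%R;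
  banach_scaleAl : forall (k : K) x y,
    k *: banach_mul x y = banach_mul (k *: x) y;
  banach_scaleAr : forall (k : K) x y,
    k *: banach_mul x y = banach_mul x (k *: y);
  banach_normM : forall x y, `|banach_mul x y| <= `|x| * `|y|
}.

Definition banach_carrier (K : numFieldType) (A : banachAlgType K) : Type :=
  banach_space A.
Coercion banach_carrier : banachAlgType >-> Sortclass.

HB.instance Definition _ (K : numFieldType) (A : banachAlgType K) :=
  CompleteNormedModule.copy (banach_carrier A) (banach_space A).
HB.instance Definition _ (K : numFieldType) (A : banachAlgType K) :=
  GRing.Zmodule_isPzRing.Build (banach_carrier A)
    (@banach_mulA K A) (@banach_mul1x K A) (@banach_mulx1 K A)
    (@banach_mulDl K A) (@banach_mulDr K A).

Section Ideals.
Context {K : numFieldType} {A : banachAlgType K}.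
Implicit Types I J : set A.

Definition linear_subspace I : Prop :=
  I 0 /\ forall (k : K) x y, I x -> I y -> I (k *: x + y).

Definition left_ideal I : Prop :=
  linear_subspace I /\ forall a x, I x -> I (a * x).

Definition two_sided_ideal I : Prop :=
  left_ideal I /\ forall a x, I x -> I (x * a).

Definition minimal_left_ideal I : Prop :=
  [/\ left_ideal I, I <> [set 0]
    & forall J, left_ideal J -> J `<=` I -> J = [set 0] \/ J = I].

(* When there is no minimal left ideal, this is the smallest left ideal,
   namely [set 0]. *)
Definition socle : set A :=
  smallest left_ideal (\bigcup_(I in minimal_left_ideal) I).

(* Linear span of the products x * y; an ideal when I and J are. *)
Definition ideal_prod I J : set A :=
  smallest linear_subspace [set x * y | x in I & y in J].

End Ideals.

Definition semiprime (K : numFieldType) (A : banachAlgType K) : Prop :=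
  forall J : set A, two_sided_ideal J -> ideal_prod J J = [set 0] ->
    J = [set 0].

Definition finite_dimensional (K : numFieldType) (A : lmodType K) : Prop :=
  exists n : nat, inhabited (Vector.axiom n A).

Arguments socle {K} A.

(* Main.v *)
Require Import Defs.
From HB Require Import structures.
From mathcomp Require Import all_boot all_order all_algebra.
From mathcomp Require Import all_classical all_reals all_analysis.
From mathcomp Require Import complex ring lra.

Set Implicit Arguments.
Unset Strict Implicit.
Unset Printing Implicit Defensive.

Import Order.TTheory GRing.Theory Num.Theory.
Import numFieldNormedType.Exports.
Local Open Scope classical_set_scope.
Local Open Scope ring_scope.
Local Open Scope complex_scope.

(** The algebra A decomposes into finitely many pieces e i A e j with e i minimal
    idempotents, and each piece is finite dimensional by the theorems of
    Gelfand-Mazur and Frobenius.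

    Finiteness of the decomposition comes from the closed socle.  In a semiprime
    algebra a minimal left ideal is generated by an idempotent (brauer), and if
    an idempotent p is not 1, the hypothesis on left ideals provides a minimal
    idempotent orthogonal to p (complement_idempotent).  Were 1 never reached by
    adding up such idempotents, there would be an infinite orthogonal sequence
    e n in the socle.  The socle being closed, it would contain a convergent sum
    x of multiples c n *: e n with c n > 0.  As an element of the socle, x lies in
    a finite sum of minimal left ideals, which is of finite length, whereas
    y |-> y * x is injective on the left ideal generated by all e n, which is of
    infinite length (no_orthogonal_sequence).  So 1 is a finite sum of minimal
    idempotents e i, and A is the sum of the spaces e i A e j.

    If e and f are minimal idempotents and e A f is not 0, it is isomorphic as a
    vector space to the corner f A f (minimal_idempotent_link), which is a normed
    division algebra.  Seen over the reals, it has dimension at most four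
    (corner_span): each of its elements satisfies a real quadratic equation with
    nonpositive discriminant (real_quadratic), and a division algebra with this
    property is spanned by four elements (frobenius_span4).

    For real_quadratic, suppose that the invertible element a satisfies no such
    equation.  Then the real part of the resolvent (1 - z a)^-1 at a complex number
    z is defined for all z, and it is Lipschitz in the modulus of z, uniformly in
    the argument, when the modulus is bounded.  The mean over z and - z gives the
    corresponding function for a^2 at z^2, so that the functions
    (1 - s^N a^N)^-1, with s real and N a power of 2, share one Lipschitz constant.
    Such a function is close to 1 when (s a)^N is small.  Starting from s = 0, one
    can therefore increase s by steps of fixed length while keeping some power
    (s a)^N small, up to any value of s; this contradicts the invertibility of a
    (not_res_regular). *)

(** * Finite spanning families *)

Section FiniteSpan.
Variables (K : fieldType) (V : lmodType K).

Definition spans (I : finType) (b : I -> V) :=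
  forall x, exists k : I -> K, x = \sum_i k i *: b i.

Lemma spans_drop n (b : 'I_n.+1 -> V) (k : 'I_n.+1 -> K) i0 :
  spans b -> \sum_i k i *: b i = 0 -> k i0 != 0 -> spans (b \o lift i0).
Proof.
move=> sb k0 ki0 x; have [l ->] := sb x.
exists (fun j => l (lift i0 j) - l i0 / k i0 * k (lift i0 j)).
under [RHS]eq_bigr do rewrite /= scalerBl -scalerA.
rewrite sumrB -scaler_sumr (bigD1_ord i0)//= addrC; congr (_ + _).
move: k0; rewrite (bigD1_ord i0)//= => /eqP; rewrite addrC addr_eq0 => /eqP ->.
by rewrite scalerN opprK scalerA divfK.
Qed.

(** A spanning family of least cardinality is free, since a nontrivial relation
    would allow one to drop a vector; its coordinates are the isomorphism. *)
Lemma spans_vector_axiom (I : finType) (b : I -> V) :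
  spans b -> exists n, inhabited (Vector.axiom n V).
Proof.
move=> sb.
have exn : exists n, `[< exists b : 'I_n -> V, spans b >].
  exists #|I|; apply/asboolP; exists (b \o enum_val) => x.
  have [k ->] := sb x; exists (k \o enum_val).
  by rewrite (reindex _ (onW_bij _ (@enum_val_bij I))).
case: (ex_minnP exn) => n /asboolP[{sb}c sc] minn; exists n.
pose f (v : 'rV[K]_n) := \sum_i v 0 i *: c i.
have flin : linear f.
  move=> a u v; rewrite /f scaler_sumr -big_split; apply: eq_bigr => i _.
  by rewrite !mxE scalerDl scalerA.
have f0 v : f v = 0 -> v = 0.
  move=> fv; apply/eqP; apply: contrapT => /negP/rV0Pn[i vi].
  case: n => [|n] in c sc minn f flin v fv i vi *; first by case: i vi.
  have /minn : `[< exists b : 'I_n -> V, spans b >].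
    by apply/asboolP; eexists; exact: spans_drop sc fv vi.
  by rewrite ltnn.
have finj : injective f.
  move=> u v fuv; apply/eqP; rewrite -subr_eq0; apply/eqP/f0.
  by rewrite addrC -scaleN1r flin fuv scaleN1r addNr.
have /choice[g gK] : forall x, exists v, f v = x.
  by move=> x; have [k ->] := sc x; exists (\row_i k i);
    apply: eq_bigr => i _; rewrite mxE.
constructor; exists g; last by exists f => // v; apply: finj; rewrite gK.
by move=> a x y; apply: finj; rewrite flin !gK.
Qed.

End FiniteSpan.

(** * Normed real division algebras: every element is quadratic *)

Section GelfandMazur.
Variables (R : realType) (D : unitAlgType R) (N : D -> R).
Hypothesis N_ge0 : forall x, 0 <= N x.
Hypothesis ND : forall x y, N (x + y) <= N x + N y.
Hypothesis NZ : forall r x, N (r *: x) = `|r| * N x.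
Hypothesis NM : forall x y, N (x * y) <= N x * N y.
Hypothesis N1_ge1 : 1 <= N 1.

(** For a complex number z = s (c + i sqrt (1 - c^2)) of modulus s, res_den a s c
    stands for (1 - z a) (1 - z' a), z' the conjugate of z, and re_resolvent a s c
    for the real part ((1 - z a)^-1 + (1 - z' a)^-1) / 2 of the resolvent.  Written
    with s and c they make sense in a real algebra. *)
Definition res_den (a : D) (s c : R) : D :=
  1 - (2 * s * c) *: a + (s ^+ 2) *: a ^+ 2.
Definition res_num (a : D) (s c : R) : D := 1 - (s * c) *: a.
Definition re_resolvent (a : D) (s c : R) : D :=
  res_num a s c * (res_den a s c)^-1.

(** The negation of the conclusion sought: no quadratic polynomial with real
    coefficients and nonpositive discriminant degenerates at a. *)
Definition res_regular (a : D) :=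
  forall s c : R, 0 <= s -> -1 <= c <= 1 -> res_den a s c \is a GRing.unit.

Local Notation ev := (@horner_alg R D).

Lemma res_denE a s c : res_den a s c =
  ev a (1 - (2 * s * c)%:P * 'X + (s ^+ 2)%:P * 'X ^+ 2).
Proof.
by rewrite rmorphD rmorphB rmorph1 !mul_polyC /= !linearZ rmorphXn
  /= horner_algX ?mulr_algl.
Qed.

Lemma res_numE a s c : res_num a s c = ev a (1 - (s * c)%:P * 'X).
Proof. by rewrite rmorphB rmorph1 mul_polyC /= linearZ /= horner_algX
  ?mulr_algl. Qed.

Lemma comm_ev a p q : GRing.comm (ev a p) (ev a q).
Proof. by rewrite /GRing.comm -!rmorphM mulrC. Qed.

Lemma res_den_sqr a s c :
  res_den (a ^+ 2) (s ^+ 2) (2 * c ^+ 2 - 1) = res_den a s c * res_den a s (- c).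
Proof.
rewrite (res_denE a s c) (res_denE a s (- c)) -(rmorphM (ev a)).
have -> : res_den (a ^+ 2) (s ^+ 2) (2 * c ^+ 2 - 1) = ev a
  (1 - (2 * s ^+ 2 * (2 * c ^+ 2 - 1))%:P * 'X ^+ 2
     + (s ^+ 2 ^+ 2)%:P * 'X ^+ 2 ^+ 2).
  by rewrite rmorphD rmorphB rmorph1 !mul_polyC /= !linearZ 3!rmorphXn
    /= horner_algX ?mulr_algl.
congr (ev a _); rewrite !(polyCM,polyCN, polyCB, polyC1) /=; ring.
Qed.

Lemma res_num_sqr a s c :
  res_num a s c * res_den a s (- c) + res_num a s (- c) * res_den a s c =
  2 *: res_num (a ^+ 2) (s ^+ 2) (2 * c ^+ 2 - 1).
Proof.
rewrite (res_denE a s c) (res_denE a s (- c)) !(res_numE a).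
rewrite -!(rmorphM (ev a)) -rmorphD.
have -> : 2 *: res_num (a ^+ 2) (s ^+ 2) (2 * c ^+ 2 - 1) = ev a (2%:P *
  (1 - (s ^+ 2 * (2 * c ^+ 2 - 1))%:P * 'X ^+ 2)).
  by rewrite !mul_polyC linearZ /= rmorphB rmorph1 /= linearZ rmorphXn
    /= horner_algX ?mulr_algl.
congr (ev a _); rewrite !(polyCM,polyCN, polyCB, polyC1) /=; ring.
Qed.

(** Averaging the resolvent over z and - z gives the resolvent of a^2 at z^2:
    (1 - z^2 a^2)^-1 = ((1 - z a)^-1 + (1 + z a)^-1) / 2.  If c is the cosine of
    an angle, then 2 c^2 - 1 is the cosine of its double. *)
Lemma re_resolvent_sqr a s c :
  res_den a s c \is a GRing.unit -> res_den a s (- c) \is a GRing.unit ->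
  re_resolvent (a ^+ 2) (s ^+ 2) (2 * c ^+ 2 - 1) =
  2^-1 *: (re_resolvent a s c + re_resolvent a s (- c)).
Proof.
move=> u1 u2; have u3 : res_den a s c * res_den a s (- c) \is a GRing.unit.
  by rewrite unitrM_comm ?u1//; rewrite !res_denE; exact: comm_ev.
rewrite /re_resolvent res_den_sqr; apply: (mulIr u3).
have e1 : res_num a s c / res_den a s c * (res_den a s c * res_den a s (- c)) =
    res_num a s c * res_den a s (- c) by rewrite mulrA divrK.
have e2 : res_num a s (- c) / res_den a s (- c) *
      (res_den a s c * res_den a s (- c)) =
    res_num a s (- c) * res_den a s c.
  have -> : res_den a s c * res_den a s (- c) = res_den a s (- c) * res_den a s c.
    by rewrite !res_denE; exact: comm_ev.
  by rewrite mulrA divrK.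
rewrite -scalerAl divrK// (mulrDl (res_num a s c / _)) e1 e2 res_num_sqr.
by rewrite scalerA mulVf ?scale1r// pnatr_eq0.
Qed.

Lemma half_angle (c : R) : -1 <= c <= 1 ->
  exists2 d, -1 <= d <= 1 & c = 2 * d ^+ 2 - 1.
Proof.
move=> /andP[c1 c2]; exists (Num.sqrt ((1 + c) / 2)).
  apply/andP; split; first by apply: le_trans (sqrtr_ge0 _); lra.
  by rewrite -[leRHS]sqrtr1; apply: ler_wsqrtr; lra.
by rewrite sqr_sqrtr; lra.
Qed.

Lemma res_regular_sqr a : res_regular a -> res_regular (a ^+ 2).
Proof.
move=> fa s c s0 /half_angle[d /andP[d1 d2] ->].
rewrite -(sqr_sqrtr s0) res_den_sqr unitrM_comm.
  by apply/andP; split; apply: fa; rewrite ?sqrtr_ge0//; lra.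
by rewrite !res_denE; exact: comm_ev.
Qed.

(** Since the resolvent of a^2 is a mean of values of the resolvent of a, an
    estimate that is uniform in the angle survives the passage from a to a^2
    with the same constant; iterating, it holds for all powers a^(2^n). *)
Lemma re_resolvent_sqr_close a s s' e : res_regular a -> 0 <= s -> 0 <= s' ->
  (forall c, -1 <= c <= 1 -> N (re_resolvent a s c - re_resolvent a s' c) <= e) ->
  forall c, -1 <= c <= 1 ->
    N (re_resolvent (a ^+ 2) (s ^+ 2) c - re_resolvent (a ^+ 2) (s' ^+ 2) c) <= e.
Proof.
move=> fa s0 s'0 H c /half_angle[d d1 ->].
have d2 : -1 <= - d <= 1 by lra.
rewrite !re_resolvent_sqr; try exact: fa.
rewrite -scalerBr NZ opprD addrACA ger0_norm ?invr_ge0//.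
have := ND (re_resolvent a s d - re_resolvent a s' d)
  (re_resolvent a s (- d) - re_resolvent a s' (- d)).
have := H _ d1; have := H _ d2; lra.
Qed.

Lemma re_resolvent_pow2_close a s s' e n : res_regular a -> 0 <= s -> 0 <= s' ->
  (forall c, -1 <= c <= 1 -> N (re_resolvent a s c - re_resolvent a s' c) <= e) ->
  forall c, -1 <= c <= 1 ->
    N (re_resolvent (a ^+ (2 ^ n)) (s ^+ (2 ^ n)) c
       - re_resolvent (a ^+ (2 ^ n)) (s' ^+ (2 ^ n)) c) <= e.
Proof.
elim: n a s s' => [|n IH] a s s' fa s0 s'0 H; first by rewrite !expr1.
rewrite expnS !exprM; apply: IH; rewrite ?exprn_ge0//.
  exact: res_regular_sqr.
exact: re_resolvent_sqr_close.
Qed.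

Lemma res_regular_pow2 a n : res_regular a -> res_regular (a ^+ (2 ^ n)).
Proof.
elim: n a => [|n IH] a fa; first by rewrite expr1.
by rewrite expnS exprM; apply/IH/res_regular_sqr.
Qed.

(** At angle 0 both factors of the denominator are 1 - s a. *)
Lemma re_resolvent1 a s : res_regular a -> 0 <= s ->
  1 - s *: a \is a GRing.unit /\ re_resolvent a s 1 = (1 - s *: a)^-1.
Proof.
move=> fa s0; have E : res_den a s 1 = (1 - s *: a) * (1 - s *: a).
  rewrite -expr2 -sqrrN opprB sqrrB1 exprZn /res_den mulr1 -[2]/(1 *+ 2).
  rewrite mulrnAl mul1r scalerMnl addrC -[RHS]addrA.
  by congr (_ + _); exact: addrC.
have : res_den a s 1 \is a GRing.unit by apply: fa => //; lra.
rewrite E unitrM_comm// andbb => u; split=> //.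
by rewrite /re_resolvent /res_num E mulr1 invrM// mulrA divrr// mul1r.
Qed.

Lemma NB x y : N (x - y) <= N x + N y.
Proof. by rewrite (le_trans (ND _ _))// -scaleN1r NZ normrN1 mul1r. Qed.

Lemma NC x y : N (x - y) = N (y - x).
Proof. by rewrite -opprB -scaleN1r NZ normrN1 mul1r. Qed.

Lemma N0 : N 0 = 0.
Proof. by rewrite -(scale0r 0) NZ normr0 mul0r. Qed.

(** Local boundedness of the inverse, with an explicit radius: expand
    y^-1 = x^-1 + x^-1 (x - y) y^-1. *)
Lemma inv_bound x y : x \is a GRing.unit -> y \is a GRing.unit ->
  N (x - y) * N x^-1 <= 2^-1 -> N y^-1 <= 2 * N x^-1.
Proof.
move=> ux uy h.
have E : y^-1 = x^-1 + x^-1 * (x - y) * y^-1.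
  by rewrite mulrBr mulVr// mulrBl mul1r mulrK// addrC subrK.
have := ND x^-1 (x^-1 * (x - y) * y^-1); rewrite -E.
have := NM (x^-1 * (x - y)) y^-1; have := NM x^-1 (x - y).
have := N_ge0 y^-1; have := N_ge0 x^-1; nra.
Qed.

Lemma res_den_dist a s c s' c' : N (res_den a s c - res_den a s' c') <=
  `|2 * s * c - 2 * s' * c'| * N a + `|s ^+ 2 - s' ^+ 2| * N (a ^+ 2).
Proof.
rewrite -!NZ NC; rewrite (_ : _ - _ = (2 * s * c - 2 * s' * c') *: a -
    (s ^+ 2 - s' ^+ 2) *: a ^+ 2); first exact: NB.
rewrite /res_den !scalerBl opprD addrACA opprB.
by rewrite [1 - _ + (_ - 1)]addrC subrKA opprB.
Qed.

(** The inverse of the denominator is locally bounded in (s, c), and the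
    parameters range over a compact rectangle. *)
Lemma res_den_inv_bound a S : res_regular a ->
  exists2 B, 0 <= B & forall s c, 0 <= s <= S -> -1 <= c <= 1 ->
    N (res_den a s c)^-1 <= B.
Proof.
move=> fa.
pose K := ([set` `[0, S]%R] `*` [set` `[-1 : R, 1]%R])%classic.
have cK : compact K by apply: compact_setX; exact: segment_compact.
have Hnear := (compact_near_coveringP K).1 cK R (pinfty_nbhs R)
  (fun i x => K x -> N (res_den a x.1 x.2)^-1 <= i) _.
have /Hnear[B [_ HB]] : forall x, K x -> \forall x' \near x & i \near +oo,
    K x' -> N (res_den a x'.1 x'.2)^-1 <= i.
  move=> [s c] Ksc.
  set w := N (res_den a s c)^-1.
  pose h (x : R * R) : R := (`|2 * s * c - 2 * x.1 * x.2| * N a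
     + `|s ^+ 2 - x.1 ^+ 2| * N (a ^+ 2)) * w.
  have ch : h x @[x --> (s, c)] --> h (s, c).
    apply: cvgM; last exact: cvg_cst.
    apply: cvgD; apply: cvgM; try exact: cvg_cst; apply: cvg_norm;
      apply: cvgB; try exact: cvg_cst.
      apply: cvgM; last exact: cvg_snd.
      by apply: cvgM; [exact: cvg_cst|exact: cvg_fst].
    by rewrite expr2; apply: cvgM; exact: cvg_fst.
  have hsc0 : h (s, c) = 0 by rewrite /h !subrr normr0 !mul0r addr0 mul0r.
  have hlt : \forall x \near (s, c), h x < 2^-1.
    by apply: (cvgr_lt (h (s, c)) ch); rewrite hsc0 invr_gt0.
  have [/andP[s0 _] c1] : 0 <= s <= S /\ -1 <= c <= 1.
    by move: Ksc; rewrite /K /= !in_itv.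
  exists ([set x | h x < 2^-1], [set i | 2 * w < i]) => /=.
    by split; [exact: hlt|apply: nbhs_pinfty_gt; exact: num_real].
  move=> [[s' c'] i] /= [hx wi] [/=]; rewrite !in_itv /= => /andP[s'0 _] c'1.
  apply: le_trans (ltW wi); apply: inv_bound; [exact: fa..|].
  apply: le_trans (ltW hx); rewrite /h ler_wpM2r//=.
  exact: res_den_dist.
exists (Num.max 0 (B + 1)); first by rewrite le_max lexx.
move=> s c s1 c1; have Ksc : K (s, c) by split=> /=; rewrite in_itv.
have B1 : B < B + 1 by rewrite ltrDl.
by apply: (le_trans (HB (B + 1) B1 (s, c) Ksc Ksc)); rewrite le_max lexx orbT.
Qed.

Lemma re_resolvent_lipschitz a S : res_regular a ->
  exists2 L, 0 <= L & forall s s' c, 0 <= s <= S -> 0 <= s' <= S ->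
    -1 <= c <= 1 -> N (re_resolvent a s c - re_resolvent a s' c) <= L * `|s - s'|.
Proof.
move=> fa; have [B B0 HB] := res_den_inv_bound S fa.
have Na := N_ge0 a; have Na2 := N_ge0 (a ^+ 2); have N1 := N_ge0 1.
have [S0|S0] := ltP S 0.
  by exists 0 => // s s' c s0; exfalso; lra.
pose M := 2 * N a + 2 * S * N (a ^+ 2).
have M0 : 0 <= M by rewrite addr_ge0// !mulr_ge0.
exists (N a * B + (N 1 + S * N a) * (B * M * B)).
  by rewrite addr_ge0// ?mulr_ge0// ?mulr_ge0// addr_ge0// mulr_ge0.
move=> s s' c s1 s'1 c1.
set p := res_num a s c; set p' := res_num a s' c.
set q := res_den a s c; set q' := res_den a s' c.
have uq : q \is a GRing.unit by apply: fa => //; lra.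
have uq' : q' \is a GRing.unit by apply: fa => //; lra.
have E : re_resolvent a s c - re_resolvent a s' c =
    (p - p') * q^-1 + p' * (q^-1 * (q' - q) * q'^-1).
  have -> : q^-1 * (q' - q) * q'^-1 = q^-1 - q'^-1.
    by rewrite mulrBr mulVr// mulrBl div1r mulrK.
  by rewrite (mulrBr p') (mulrBl q^-1) addrA subrK.
have c0 : `|c| <= 1 by rewrite ler_norml; lra.
have d0 : 0 <= `|s - s'| by [].
have sc : `|s * c - s' * c| <= `|s - s'|.
  by rewrite -mulrBl normrM ler_piMr.
have b1 : N (p - p') <= `|s - s'| * N a.
  rewrite NC /p /p' /res_num opprB addrC subrKA -scalerBl NZ.
  by rewrite ler_wpM2r.
have b2 : N p' <= N 1 + S * N a.
  rewrite (le_trans (NB _ _))// lerD2l NZ ler_wpM2r// normrM.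
  rewrite ger0_norm; last lra.
  by rewrite (le_trans (ler_piMr _ c0)); lra.
have b3 : N (q' - q) <= `|s - s'| * M.
  rewrite NC (le_trans (res_den_dist _ _ _ _ _))// /M mulrDr lerD//.
    rewrite -!mulrA -!mulrBr normrM normr_nat !mulrA [_ * 2]mulrC ler_wpM2r//.
    by rewrite ler_wpM2l.
  rewrite !mulrA ler_wpM2r// subr_sqr normrM -mulrA ler_wpM2l//.
  rewrite ger0_norm; lra.
have b4 : N q^-1 <= B by exact: HB.
have b5 : N q'^-1 <= B by exact: HB.
rewrite E (le_trans (ND _ _))// [leRHS]mulrDl lerD//.
  by rewrite (le_trans (NM _ _))// mulrAC [N a * _]mulrC ler_pM.
rewrite (le_trans (NM _ _))// -[leRHS]mulrA ler_pM//.
rewrite (le_trans (NM _ _))// [leRHS]mulrAC ler_pM//.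
by rewrite (le_trans (NM _ _))// -[leRHS]mulrA [M * _]mulrC ler_pM.
Qed.

(** The next two lemmas are converse to each other: (1 - x)^-1 is close to 1
    exactly when x is small, which turns estimates on resolvents into estimates
    on powers. *)
Lemma inv1B_close x : 1 - x \is a GRing.unit ->
  (1 - N x) * N ((1 - x)^-1 - 1) <= N x.
Proof.
move=> ux; set g := (1 - x)^-1.
have E : g - 1 = x + x * (g - 1).
  have : (1 - x) * g = 1 by rewrite mulrV.
  rewrite mulrBr mulr1 [x + _]addrC subrK mulrBl mul1r => <-.
  by rewrite subKr.
have := ND x (x * (g - 1)); rewrite -E; have := NM x (g - 1); lra.
Qed.

Lemma close_inv1B g : g \is a GRing.unit ->
  (1 - N (g - 1)) * N (1 - g^-1) <= N (g - 1).
Proof.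
move=> ug; set x := 1 - g^-1.
have E : x = (g - 1) - (g - 1) * x.
  by rewrite /x mulrBr mulr1 subKr mulrBl divrr// mul1r.
have := NB (g - 1) ((g - 1) * x); rewrite -E; have := NM (g - 1) x; lra.
Qed.

Lemma normX_le x n : N (x ^+ n.+1) <= N x ^+ n.+1.
Proof.
elim: n => [|n IH]; first by rewrite !expr1.
by rewrite exprS (le_trans (NM _ _))// [leRHS]exprS ler_wpM2l.
Qed.

(** Closeness of the two resolvents of a passes to those of a^(2^(n+1)), where
    smallness of (s a)^(2^n) forces the first one to be near 1; hence so is the
    second one, and (s' a)^(2^(n+1)) is small.  The constants are such that the
    bound 1/4 is reproduced: squaring gives 1/16, the first resolvent is within
    1/15 of 1, the second within 1/15 + 1/10 = 1/6, and its power is at most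
    (1/6) / (5/6) < 1/4. *)
Lemma normX_expand a s s' n : res_regular a -> 0 <= s -> 0 <= s' ->
  (forall c, -1 <= c <= 1 -> N (re_resolvent a s c - re_resolvent a s' c) <= 10^-1) ->
  N ((s *: a) ^+ (2 ^ n)) <= 4^-1 -> N ((s' *: a) ^+ (2 ^ n.+1)) <= 4^-1.
Proof.
move=> fa s0 s'0 H Hn.
have := re_resolvent_pow2_close n.+1 fa s0 s'0 H.
have fan := res_regular_pow2 n.+1 fa.
have c1 : -1 <= (1 : R) <= 1 by apply/andP; split; lra.
move=> /(_ 1 c1).
have [u ->] := re_resolvent1 fan (exprn_ge0 (2 ^ n.+1) s0).
have [u' ->] := re_resolvent1 fan (exprn_ge0 (2 ^ n.+1) s'0).
move: u u'; rewrite -!exprZn; set x := (s *: a) ^+ _; set x' := (s' *: a) ^+ _.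
move=> u u' close.
have xs : N x <= 16^-1.
  rewrite /x expnS mulnC exprM expr2 (le_trans (NM _ _))//.
  rewrite (_ : 16^-1 = 4^-1 * 4^-1); last lra.
  exact: ler_pM.
have gu : (1 - x')^-1 \is a GRing.unit by rewrite unitrV.
have := close_inv1B gu; rewrite invrK subKr => hx'.
have hx := inv1B_close u.
have := NB ((1 - x)^-1 - 1) ((1 - x)^-1 - (1 - x')^-1).
rewrite opprB addrC subrKA => htri.
have x0 := N_ge0 x; have x'0 := N_ge0 x'.
set d := N ((1 - x)^-1 - 1) in hx htri.
set d' := N ((1 - x')^-1 - 1) in hx' htri.
have d0 : 0 <= d by exact: N_ge0.
have d'0 : 0 <= d' by exact: N_ge0.
have d15 : d <= 15^-1 by nra.
have d6 : d' <= 6^-1 by lra.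
nra.
Qed.

(** The Lipschitz estimate gives a step d that works throughout [0, S], so by
    normX_expand some power of k d a has norm at most 1/4 as long as k d <= S.
    This is absurd once k d exceeds the norm of a^-1. *)
Theorem not_res_regular a : a \is a GRing.unit -> ~ res_regular a.
Proof.
move=> ua fa; pose S := N a^-1 + 1.
have Nai := N_ge0 a^-1.
have [L L0 HL] := re_resolvent_lipschitz S fa.
pose d := (10 * (L + 1))^-1.
have d0 : 0 < d by rewrite invr_gt0; lra.
have d1 : d <= 1 by rewrite invf_le1; lra.
have dL : L * d <= 10^-1.
  rewrite /d invfM mulrCA ler_piMr ?invr_ge0// ler_pdivrMr; lra.
have claim k : k%:R * d <= S ->
    exists n, N (((k%:R * d) *: a) ^+ (2 ^ n)) <= 4^-1.
  elim: k => [|k IH] kS.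
    by exists 0%N; rewrite mul0r scale0r expr1 N0 invr_ge0.
  have kk : k.+1%:R * d = k%:R * d + d by rewrite -natr1 mulrDl mul1r.
  have k0 : 0 <= k%:R * d by rewrite mulr_ge0// ltW.
  case: IH => [|n Hn]; first lra.
  exists n.+1; apply: normX_expand Hn => //; first lra.
  move=> c c1; rewrite (le_trans (HL _ _ _ _ _ c1))//; try lra.
  by rewrite kk opprD addrA subrr sub0r normrN gtr0_norm.
pose k := Num.truncn (S / d).
have S0 : 0 <= S / d by rewrite divr_ge0 ?ltW// /S; lra.
have /andP[k1 k2] := truncn_itv S0.
move: k1 k2; rewrite -/k ler_pdivlMr// ltr_pdivrMr// => k1.
rewrite -natr1 mulrDl mul1r => k2.
have [n Hn] := claim k k1.
set s := k%:R * d in k1 k2 Hn.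
have sa : N a^-1 <= s by rewrite /S in k2; lra.
have s0 : 0 < s by rewrite /S in k2; lra.
have us : s \is a GRing.unit by rewrite unitfE gt_eqF.
have E : 1 = (s *: a) ^+ (2 ^ n) * (s^-1 *: a^-1) ^+ (2 ^ n).
  have cm : GRing.comm (s *: a) (s^-1 *: a^-1).
    by rewrite /GRing.comm -!scalerAl -!scalerAr !scalerA mulrV//
      mulVr// divrr// mulVr.
  rewrite -exprMn_comm// -scalerAl -scalerAr scalerA mulrV// divrr//.
  by rewrite scale1r expr1n.
have := NM ((s *: a) ^+ (2 ^ n)) ((s^-1 *: a^-1) ^+ (2 ^ n)); rewrite -E.
have hle : N ((s^-1 *: a^-1) ^+ (2 ^ n)) <= 1.
  rewrite -(prednK (expn_gt0 2 n)) (le_trans (normX_le _ _))//.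
  rewrite exprn_ile1// NZ gtr0_norm ?invr_gt0// mulrC ler_pdivrMr//.
  by rewrite mul1r.
have := ler_pM (N_ge0 _) (N_ge0 _) Hn hle; rewrite mulr1 => h1 h2.
have := le_trans N1_ge1 (le_trans h2 h1); rewrite leNgt invf_lt1 ?ltr1n//.
Qed.

Hypothesis divD : forall x : D, x != 0 -> x \is a GRing.unit.

(** Gelfand-Mazur in real form: if the quadratic res_den a s c vanishes, dividing
    by s^2 and completing the square gives the normal form stated here. *)
Theorem real_quadratic (a : D) :
  exists al ga : R, (a - al%:A) ^+ 2 = - (ga ^+ 2)%:A :> D.
Proof.
have [->|a0] := eqVneq a 0.
  by exists 0, 0; rewrite scale0r subr0 !expr0n /= scale0r oppr0.
have /existsNP[s /existsNP[c]] := not_res_regular (divD a0).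
move=> /not_implyP[s0] /not_implyP[/andP[c1 c2]] nu.
have Q0 : res_den a s c = 0.
  by apply/eqP; apply: contra_notT nu; exact: divD.
have sn0 : s != 0.
  apply/eqP => se; move: Q0; rewrite /res_den se.
  rewrite mulr0 mul0r scale0r expr0n /= scale0r subr0 addr0 => /eqP.
  by rewrite oner_eq0.
exists (c / s), (Num.sqrt (1 - c ^+ 2) / s).
apply/eqP; rewrite -addr_eq0; apply/eqP.
pose t := s^-1; have st : s%:P * t%:P = 1 :> {poly R}.
  by rewrite -polyCM mulfV.
have -> : (Num.sqrt (1 - c ^+ 2) / s) ^+ 2 = (1 - c ^+ 2) * t ^+ 2.
  rewrite exprMn sqr_sqrtr//.
  by rewrite (_ : 1 - c ^+ 2 = (1 - c) * (1 + c)) ?mulr_ge0//; [lra|lra|ring].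
have -> : (a - (c / s)%:A) ^+ 2 + ((1 - c ^+ 2) * t ^+ 2)%:A =
    ev a (('X - (c * t)%:P) ^+ 2 + ((1 - c ^+ 2) * t ^+ 2)%:P).
  by rewrite rmorphD rmorphXn rmorphB /= horner_algX !horner_algC.
have -> : ('X - (c * t)%:P) ^+ 2 + ((1 - c ^+ 2) * t ^+ 2)%:P =
    (t ^+ 2)%:P * (1 - (2 * s * c)%:P * 'X + (s ^+ 2)%:P * 'X ^+ 2).
  rewrite !(polyCM,polyCN, polyCB, polyC1) /=; ring: st.
by rewrite (rmorphM (ev a)) /= -(res_denE a s c) Q0 mulr0.
Qed.
End GelfandMazur.

(** * Quadratic real division algebras have dimension at most four *)

Section Frobenius.
Variables (R : rcfType) (D : unitAlgType R).
Hypothesis divD : forall x : D, x != 0 -> x \is a GRing.unit.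
Hypothesis quadD : forall a : D,
  exists al ga : R, (a - al%:A) ^+ 2 = - (ga ^+ 2)%:A :> D.

Lemma div_mul0 (x y : D) : x * y = 0 -> x = 0 \/ y = 0.
Proof.
move=> xy; have [->|/divD ux] := eqVneq x 0; [by left|right].
by rewrite -(mulKr ux y) xy mulr0.
Qed.

(** Complete the square so that y = x - al satisfies y^2 = (ga i)^2; as y and i
    commute, the difference of squares factors. *)
Lemma centralizer_i (i x : D) : i ^+ 2 = -1 -> GRing.comm i x ->
  exists p q : R, x = p%:A + q *: i.
Proof.
move=> ii ix; have [al [ga E0]] := quadD x.
have [y [xE E iy]] : exists y, [/\ x = al%:A + y, y ^+ 2 = - (ga ^+ 2)%:A
    & i * y = y * i].
  exists (x - al%:A); split=> //; first by rewrite addrC subrK.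
  by rewrite mulrBr mulrBl ix mulr_algl mulr_algr.
have : (y - ga *: i) * (y + ga *: i) = 0.
  rewrite mulrBl !mulrDr -(expr2 y) E -!scalerAl -!scalerAr iy -(expr2 i) ii.
  by rewrite scalerA -expr2 scalerN [X in _ - X]addrC subrr.
case/div_mul0 => /eqP; rewrite ?subr_eq0 ?addr_eq0 => /eqP yE.
  by exists al, ga; rewrite xE yE.
by exists al, (- ga); rewrite xE yE scaleNr.
Qed.

(** With i^2 = -1, every x is the half sum of x - i x i, which commutes with i,
    and x + i x i, which anticommutes with it.  Right multiplication by a fixed
    nonzero anticommuting j exchanges the two kinds, so both parts lie in
    two-dimensional spaces. *)
Theorem frobenius_span4 : exists b : 'I_4 -> D,
  forall x, exists k : 'I_4 -> R, x = \sum_i k i *: b i.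
Proof.
have [sc|] := pselect (forall x : D, exists p : R, x = p%:A).
  exists (fun=> 1) => x; have [p ->] := sc x.
  exists (fun i => if i == 0 then p else 0).
  rewrite (bigD1 0)//= big1 ?addr0// => i /negbTE ->.
  by rewrite scale0r.
move=> /existsNP[a na].
have [al [ga E]] := quadD a.
have ga0 : ga != 0.
  apply/eqP => g0; move: E; rewrite g0 expr0n /= scale0r oppr0 expr2.
  by case/div_mul0 => /eqP; rewrite subr_eq0 => /eqP aE; apply: na; exists al.
pose i : D := ga^-1 *: (a - al%:A).
have ii : i * i = -1.
  rewrite -expr2 /i exprZn E scalerN scalerA -exprMn mulVf// expr1n scale1r//.
clearbody i.
(* w is the inverse of a nonzero j anticommuting with i, or 0 if there is none. *)
have [w Hw] : exists w, forall x : D, i * x = - (x * i) ->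
    exists p q : R, x = (p%:A + q *: i) * w.
  have [ac|/existsNP[j /not_implyP[ij /eqP j0]]] :=
      pselect (forall x : D, i * x = - (x * i) -> x = 0).
    by exists 0 => x /ac ->; exists 0, 0; rewrite mulr0.
  exists j^-1 => x ix; have uj := divD j0.
  have [p [q E']] : exists p q : R, x * j = p%:A + q *: i.
    apply: centralizer_i; first by rewrite expr2.
    by rewrite /GRing.comm mulrA ix mulNr -(mulrA x i) ij mulrN opprK mulrA.
  by exists p, q; rewrite -E' mulrK.
exists (fun k => nth 0 [:: 1; i; w; i * w] k) => x.
have [y iy yi] : exists2 y, i * y = - (x * i) & y * i = - (i * x).
  exists (i * x * i); first by rewrite !mulrA ii mulN1r mulNr.
  by rewrite -mulrA ii mulrN1.
have [p [q E1]] : exists p q : R, x - y = p%:A + q *: i.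
  apply: centralizer_i; first by rewrite expr2.
  by rewrite /GRing.comm mulrBr mulrBl iy yi !opprK addrC.
have [p' [q' E2]] : exists p q : R, x + y = (p%:A + q *: i) * w.
  by apply: Hw; rewrite mulrDr mulrDl iy yi opprB addrC.
exists (fun k => nth 0 [:: p / 2; q / 2; p' / 2; q' / 2] k).
rewrite !big_ord_recl big_ord0 /= addr0.
have -> : x = 2^-1 *: ((x - y) + (x + y)).
  by rewrite addrCA subrK -mulr2n -(scaler_nat 2 x) scalerA mulVf ?scale1r.
rewrite E1 E2 mulrDl !scalerDr -!scalerAl !mul1r !scalerA !addrA.
by rewrite ![_^-1 * _]mulrC.
Qed.
End Frobenius.

(** * Orthogonal sequences of idempotents *)

Section OrthogonalIdempotents.
Variable A : pzRingType.
Implicit Types (s : seq A) (a m x y : A) (e : nat -> A).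

(** The cyclic left module generated by m is simple or zero. *)
Definition simple_element (m : A) :=
  forall a, a * m != 0 -> exists c, c * (a * m) = m.

Definition orthogonal_idempotents (e : nat -> A) :=
  forall i j, e i * e j = e i *+ (i == j).

Lemma orth0 (e : nat -> A) i j : orthogonal_idempotents e -> (i != j)%N ->
  e i * e j = 0.
Proof. by move=> -> /negbTE ->. Qed.

Lemma orth_sumr (e : nat -> A) i n : orthogonal_idempotents e -> (i < n)%N ->
  e i * \sum_(k < n) e k = e i.
Proof.
move=> oe lin; rewrite mulr_sumr (bigD1 (Ordinal lin))//= oe eqxx mulr1n.
by rewrite big1 ?addr0// => k ki; rewrite orth0// eq_sym.
Qed.

(** Gaussian elimination with minimal left ideals in place of lines: the left ideal
    generated by an infinite orthogonal sequence cannot be embedded in finitely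
    many simple modules.  If e j * m <> 0, pick c with c * (e j * m) = m; then
    e n - e n * c * e j kills m, and for n > j these elements form again an
    orthogonal sequence of nonzero idempotents, inside the left ideal generated
    by the former one. *)
Lemma orthogonal_elimination (s : seq A) (e : nat -> A) :
  (forall m, m \in s -> simple_element m) ->
  orthogonal_idempotents e -> (forall i, e i != 0) ->
  exists y n, [/\ y != 0, y * \sum_(k < n) e k = y &
    forall m, m \in s -> y * m = 0].
Proof.
elim: s e => [|m s IH] e Hs oe e0.
  by exists (e 0%N), 1%N; split=> //; rewrite big_ord1 oe eqxx.
have Hs' x : x \in s -> simple_element x.
  by move=> xs; apply: Hs; rewrite inE xs orbT.
have [em|/existsNP[j /eqP ejm]] := pselect (forall i, e i * m = 0).
  have [y [n [y0 yn ys]]] := IH e Hs' oe e0.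
  exists y, n; split=> // x; rewrite inE => /orP[/eqP ->|]; last exact: ys.
  by rewrite -yn -mulrA mulr_suml big1 ?mulr0// => k _.
have [c cm] := Hs m (mem_head _ _) _ ejm.
pose b k := e k * c * e j.
have bm k : b k * m = e k * m by rewrite /b -!mulrA cm.
pose f n := e (j.+1 + n)%N - b (j.+1 + n)%N.
have nej n : (j == j.+1 + n)%N = false by apply/negbTE; rewrite neq_ltn leq_addr.
have be k n : b k * e (j.+1 + n)%N = 0.
  by rewrite /b -mulrA oe nej mulr0.
have of_ : orthogonal_idempotents f.
  move=> i k; rewrite /f mulrBr !mulrBl be subr0 oe eqn_add2l.
  have -> : b (j.+1 + i)%N * b (j.+1 + k)%N = 0.
    by rewrite {2}/b !mulrA be !mul0r.
  rewrite subr0 /b !mulrA oe eqn_add2l.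
  by case: eqP => [->|_]; rewrite ?mulr1n// !mulr0n !mul0r subr0.
have f0 i : f i != 0.
  apply: contra_neq (e0 (j.+1 + i)%N) => fi.
  have : f i * e (j.+1 + i)%N = e (j.+1 + i)%N.
    by rewrite /f mulrBl be subr0 oe eqxx.
  by rewrite fi mul0r.
have [y [n [y0 yn ys]]] := IH f Hs' of_ f0.
exists y, (j.+1 + n)%N; split=> //.
  rewrite -{1}yn -mulrA mulr_suml -{2}yn; congr (_ * _).
  apply: eq_bigr => k _; rewrite /f mulrBl (orth_sumr oe)//.
    by rewrite /b -!mulrA (orth_sumr oe)// ltn_addr.
  by rewrite ltn_add2l.
move=> x; rewrite inE => /orP[/eqP ->|]; last exact: ys.
rewrite -yn -mulrA mulr_suml big1 ?mulr0// => k _.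
by rewrite /f mulrBl bm subrr.
Qed.

End OrthogonalIdempotents.

(** * The socle of a Banach algebra *)

Section Socle.
Variables (K : numFieldType) (A : banachAlgType K).
Implicit Types (I M : set A) (a b e m p u x y : A).

Lemma banach_scalel (k : K) x : k *: x = (k *: (1 : A) : A) * x.
Proof. by rewrite -{1}[x]mul1r; exact: banach_scaleAl. Qed.

Lemma banach_scalerAl (k : K) x y : k *: (x * y) = (k *: x : A) * y.
Proof. exact: banach_scaleAl. Qed.

Lemma banach_scalerAr (k : K) x y : k *: (x * y) = x * (k *: y : A).
Proof. exact: banach_scaleAr. Qed.

Lemma left_idealI I : I 0 -> (forall x y, I x -> I y -> I (x + y)) ->
  (forall a x, I x -> I (a * x)) -> left_ideal I.
Proof.
move=> I0 ID IM; split=> //; split=> // k x y Ix Iy; apply: ID => //.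
by rewrite banach_scalel; exact: IM.
Qed.

Lemma left_idealD I x y : left_ideal I -> I x -> I y -> I (x + y).
Proof. by move=> [[_ h] _] Ix Iy; rewrite -[x]scale1r; exact: h. Qed.

Lemma left_idealZ I (k : K) x : left_ideal I -> I x -> I (k *: x).
Proof. by move=> [[I0 h] _] Ix; rewrite -[_ *: _]addr0; exact: h. Qed.

Lemma minimal_generator M m x : minimal_left_ideal M -> M m -> m != 0 ->
  M x -> exists a, x = a * m.
Proof.
move=> [[[M0 Mlin] Mmul] Mn0 Mmin] Mm m0 Mx.
pose J : set A := [set z | exists a, z = a * m].
have lJ : left_ideal J.
  apply: left_idealI => [|z t [a ->] [b ->]|a z [b ->]].
  - by exists 0; rewrite mul0r.
  - by exists (a + b); rewrite mulrDl.
  - by exists (a * b); rewrite mulrA.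
have sJ : J `<=` M by move=> z [a ->]; exact: Mmul.
have Jm : J m by exists 1; rewrite mul1r.
have [J0|JM] := Mmin J lJ sJ.
  by move: m0; rewrite (_ : m = 0) ?eqxx//; move: Jm; rewrite J0.
by move: Mx; rewrite -JM.
Qed.

Lemma minimal_simple_element M m : minimal_left_ideal M -> M m ->
  simple_element m.
Proof.
move=> Mmin Mm a am0; have [[_ Mmul] _ _] := Mmin.
have [c mE] := minimal_generator Mmin (Mmul a m Mm) am0 Mm.
by exists c.
Qed.

Lemma socle_left_ideal : left_ideal (socle A).
Proof.
apply: left_idealI => [J [[[J0 _] _] _]//|x y sx sy J HJ|a x sx J HJ].
- by apply: left_idealD; [case: HJ|exact: sx|exact: sy].
- by case: (HJ) => [[_ JM] _]; apply: JM; exact: sx.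
Qed.

Lemma minimal_sub_socle M : minimal_left_ideal M -> M `<=` socle A.
Proof. by move=> Mmin x Mx J [_]; apply; exists M. Qed.

(** Finite sums of elements of minimal left ideals form a left ideal, hence
    exhaust the socle. *)
Lemma socle_sum x : socle A x -> exists2 s : seq A,
  (forall m, m \in s -> simple_element m) & x = \sum_(m <- s) m.
Proof.
pose T : set A := [set x | exists2 s : seq A,
  (forall m, m \in s -> exists2 M, minimal_left_ideal M & M m) &
  x = \sum_(m <- s) m].
move=> sx; suff [s Hs ->] : T x.
  exists s => // m /Hs[M Mmin Mm]; exact: minimal_simple_element Mmin Mm.
apply: (smallest_sub _ _ sx).
  apply: left_idealI => [|y z [s Hs ->] [t Ht ->]|a y [s Hs ->]].
  - by exists [::] => //; rewrite big_nil.
  - exists (s ++ t); last by rewrite big_cat.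
    by move=> m; rewrite mem_cat => /orP[/Hs|/Ht].
  - exists [seq a * m | m <- s]; last by rewrite big_map mulr_sumr.
    move=> _ /mapP[m /Hs[M Mmin Mm] ->]; exists M => //.
    by case: Mmin => [[_ MM] _ _]; exact: MM.
move=> m [M Mmin Mm]; exists [:: m]; last by rewrite big_seq1.
by move=> _ /[!inE] /eqP ->; exists M.
Qed.

(** The field of scalars is archimedean; this is what makes geometric series
    converge. *)
Hypothesis small_pow2 : forall eps : K, 0 < eps -> exists n, 2^-1 ^+ n < eps.

(** A closed socle contains x = sum_n c n *: e n for fast decreasing c n > 0.
    Right multiplication by x is injective on the left ideal generated by the
    e n, because y * x * e k = c k *: (y * e k); but x is a finite sum of elements
    of minimal left ideals, and orthogonal_elimination yields a nonzero y in that
    left ideal killing all of them. *)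
Lemma no_orthogonal_sequence (e : nat -> A) : closed (socle A) ->
  orthogonal_idempotents e -> (forall i, e i != 0) ->
  (forall i, socle A (e i)) -> False.
Proof.
move=> cS oe e0 se.
pose c n : K := 2^-1 ^+ n.+1 / (1 + `|e n|).
have ne n : 0 < 1 + `|e n| by rewrite ltr_pwDl.
have c0 n : 0 < c n by rewrite divr_gt0// exprn_gt0// invr_gt0.
have ce n : `|c n *: e n| <= 2^-1 ^+ n.+1.
  rewrite normrZ gtr0_norm// /c -mulrA ler_piMr ?exprn_ge0 ?invr_ge0//.
  by rewrite mulrC ler_pdivrMr// mul1r lerDr.
pose s n := \sum_(k < n) c k *: e k.
have sd n k : `|s (n + k)%N - s n| <= 2^-1 ^+ n - 2^-1 ^+ (n + k).
  elim: k => [|k IH]; first by rewrite addn0 !subrr normr0.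
  rewrite addnS [s _.+1]big_ord_recr -/(s (n + k)%N) /= addrAC.
  rewrite (le_trans (ler_normD _ _))//.
  rewrite (le_trans (lerD IH (ce _)))// -addrA lerD2l exprS.
  set t := 2^-1 ^+ _.
  have tE : t = 2^-1 * t + 2^-1 * t by field.
  by rewrite {1}tE opprD subrK.
have cs : cauchy (s @ \oo).
  apply: cauchy_exP => eps eps0; have [n ne0] := small_pow2 eps0.
  exists (s n); exists n => // m /= nm; rewrite -ball_normE /= distrC.
  rewrite -(subnKC nm) (le_lt_trans (sd _ _))// (lt_trans _ ne0)//.
  by rewrite ltrBlDr ltrDl exprn_gt0// invr_gt0.
have /cauchy_cvgP/cvg_ex[/= x sx] := cs.
have socx : socle A x.
  apply: (closed_cvg _ cS _ _ sx); apply: nearW => n.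
  rewrite /s; elim/big_ind: _ => [|u v su sv|k _].
  - by case: socle_left_ideal => [[]].
  - exact: left_idealD socle_left_ideal su sv.
  - exact: left_idealZ socle_left_ideal (se k).
have ex n : e n * x = c n *: e n.
  apply/eqP; rewrite -subr_eq0 -normr_eq0; apply: contrapT => /negP d0.
  set d := `|_| in d0; have dgt0 : 0 < d by rewrite lt0r d0 normr_ge0.
  have : \forall m \near \oo, (n < m)%N /\ `|x - s m| < d / (1 + `|e n|).
    apply: filterI; first exact: nbhs_infty_gt.
    by move/cvgrPdist_lt : sx; apply; rewrite divr_gt0.
  case=> m _ /(_ m (leqnn m)) /= [nm]; rewrite ltr_pdivlMr// => dlt.
  have esm : e n * s m = c n *: e n.
    rewrite /s mulr_sumr (bigD1 (Ordinal nm))//= -banach_scalerAr oe eqxx.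
    rewrite mulr1n big1 ?addr0// => k kn.
    by rewrite -banach_scalerAr orth0 ?scaler0// eq_sym.
  have : d < d by apply: le_lt_trans dlt; rewrite /d -esm -mulrBr
    (le_trans (banach_normM _ _))// mulrC ler_wpM2l// lerDr.
  by rewrite ltxx.
have [l Hl xl] := socle_sum socx.
have [y [n [y0 yn yl]]] := orthogonal_elimination Hl oe e0.
have yx : y * x = 0.
  by rewrite xl mulr_sumr big_seq big1// => m ml; exact: yl.
have yxs : y * x = \sum_(k < n) c k *: (y * e k).
  rewrite -{1}yn -mulrA mulr_suml mulr_sumr; apply: eq_bigr => k _.
  by rewrite ex banach_scalerAr.
have ye (k : 'I_n) : y * e k = 0.
  have : y * x * e k = c k *: (y * e k).
    rewrite yxs mulr_suml (bigD1 k)//= -banach_scalerAl -mulrA oe eqxx mulr1n.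
    rewrite big1 ?addr0// => i ik.
    by rewrite -banach_scalerAl -mulrA orth0 ?mulr0 ?scaler0.
  rewrite yx mul0r => /esym/eqP; rewrite scaler_eq0 gt_eqF// => /eqP//.
by move/eqP: y0; apply; rewrite -yn mulr_sumr big1.
Qed.

End Socle.

Section IdempotentExhaustion.
Variables (A : pzRingType) (P : A -> Prop).

(** Keep adding to an idempotent p <> 1 an idempotent orthogonal to it: either the
    sum reaches 1 after finitely many steps, or the summands form an infinite
    orthogonal sequence. *)
Lemma idempotent_exhaustion :
  (forall p : A, p * p = p -> p != 1 ->
     exists f, [/\ P f, f * f = f, p * f = 0 & f * p = 0]) ->
  (exists n (e : nat -> A),
     (forall i, (i < n)%N -> P (e i)) /\ 1 = \sum_(i < n) e i) \/
  (exists e, orthogonal_idempotents e /\ forall i, P (e i)).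
Proof.
move=> step.
have /choice[F HF] : forall p : A, exists f, p * p = p -> p != 1 ->
    [/\ P f, f * f = f, p * f = 0 & f * p = 0].
  move=> p; have [pp|npp] := eqVneq (p * p) p; last first.
    by exists 0 => pp; rewrite pp eqxx in npp.
  have [->|p1] := eqVneq p 1; first by exists 0.
  by have [f Hf] := step p pp p1; exists f.
have [q [q0 qS]] : exists q : nat -> A, q 0%N = 0 /\
    forall n, q n.+1 = q n + F (q n).
  by exists (fun n => iter n (fun p => p + F p) 0).
have qq n : (forall i, (i < n)%N -> q i != 1) -> q n * q n = q n.
  elim: n => [|n IH] h; first by rewrite q0 mul0r.
  have qn : q n * q n = q n by apply: IH => i lin; apply: h; exact: ltnW.
  have [_ ff qf fq] := HF _ qn (h n (ltnSn n)).
  by rewrite qS mulrDl !mulrDr qn ff qf fq addr0 add0r.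
have qE n : q n = \sum_(i < n) F (q i).
  elim: n => [|n IH]; first by rewrite big_ord0.
  by rewrite big_ord_recr /= -IH.
have [exn|/forallNP q1] := pselect (exists n, q n == 1).
  case: (ex_minnP exn) => n /eqP qn1 minn; left.
  exists n, (F \o q); split; last by rewrite -qE.
  move=> i lin; have q1 k : (k <= i)%N -> q k != 1.
    move=> ki; apply/negP => /minn; rewrite leqNgt => /negP; apply.
    exact: leq_ltn_trans lin.
  by have [] := HF _ (qq i (fun k ki => q1 k (ltnW ki))) (q1 i (leqnn i)).
right; exists (F \o q).
have {}q1 i : q i != 1 by apply/negP.
have {}qq i : q i * q i = q i by exact: qq.
have {}HF i := HF _ (qq i) (q1 i).
(* q (i.+1 + k) contains the summand F (q i), and the later summands are
   orthogonal to it. *)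
have absorb i k : F (q i) * q (i.+1 + k)%N = F (q i) /\
    q (i.+1 + k)%N * F (q i) = F (q i).
  elim: k => [|k [IH1 IH2]].
    have [_ ff qf fq] := HF i.
    by rewrite addn0 qS mulrDl mulrDr ff qf fq !add0r.
  have [_ _ qf fq] := HF (i.+1 + k)%N.
  rewrite addnS qS mulrDl mulrDr IH1 IH2; split.
    by rewrite -{2}IH1 -mulrA qf mulr0 addr0.
  by rewrite -{2}IH2 mulrA fq mul0r addr0.
split=> [i j|i]; last by have [] := HF i.
have lt_case a b : (a < b)%N -> F (q a) * F (q b) = 0 /\ F (q b) * F (q a) = 0.
  move=> ab; have [E1 E2] := absorb a (b - a.+1)%N.
  rewrite subnKC// in E1 E2; have [_ _ qf fq] := HF b.
  by split; [rewrite -E1 -mulrA qf mulr0|rewrite -E2 mulrA fq mul0r].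
by case: ltngtP => [/lt_case[]|/lt_case[]|->] //=; have [] := HF j.
Qed.
End IdempotentExhaustion.

(** * Minimal idempotents of a semiprime algebra *)

(** The ring-theoretic content of: e is idempotent and A e is a minimal left
    ideal.  Every element u of A e satisfies u * e = u. *)
Definition minimal_idempotent (A : pzRingType) (e : A) :=
  [/\ e * e = e, e != 0 &
      forall u, u * e = u -> u != 0 -> exists b, b * u = e].

Section Semiprime.
Variables (K : numFieldType) (A : banachAlgType K).
Implicit Types (I M : set A) (a b e f m p u x y z w : A).
Hypothesis sA : semiprime A.

(** If M * M = 0, then the left annihilator L of M and the right annihilator of L
    are two-sided ideals containing M.  Their intersection J has square zero, so
    it vanishes, and M with it. *)
Lemma minimal_left_ideal_square M : minimal_left_ideal M ->
  exists m x, [/\ M m, M x & m * x != 0].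
Proof.
move=> Mmin; have [[[M0 Mlin] MM] Mn0 _] := Mmin.
apply: contrapT => none; apply: Mn0.
have MM0 m x : M m -> M x -> m * x = 0.
  move=> Mm Mx; apply/eqP; apply: contrapT => /negP mx0.
  by apply: none; exists m, x.
pose J : set A := [set z | (forall y, M y -> z * y = 0) /\
  forall w, (forall y, M y -> w * y = 0) -> w * z = 0].
have tJ : two_sided_ideal J.
  split.
    apply: left_idealI => [|z t [z1 z2] [t1 t2]|a z [z1 z2]].
    - by split=> [y _|w _]; rewrite ?mul0r ?mulr0.
    - by split=> [y My|w Hw]; rewrite ?mulrDl ?mulrDr ?z1 ?t1 ?z2 ?t2 ?addr0.
    - split=> [y My|w Hw]; first by rewrite -mulrA z1// mulr0.
      by rewrite mulrA z2// => y My; rewrite -mulrA Hw//; exact: MM.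
  move=> a z [z1 z2]; split=> [y My|w Hw].
    by rewrite -mulrA z1//; exact: MM.
  by rewrite mulrA z2// mul0r.
have JJ : ideal_prod J J = [set 0].
  apply/seteqP; split.
    apply: smallest_sub.
      by split=> // k x y -> ->; rewrite scaler0 addr0.
    by move=> _ [z [z1 _]] [t [_ t2]] <-; exact: t2.
  by move=> _ -> L [[L0 _] _].
have J0 := sA tJ JJ.
apply/seteqP; split=> [m Mm|_ ->//].
rewrite -J0; split=> [y My|w Hw]; first exact: MM0.
exact: Hw.
Qed.

(** Brauer's lemma: choose m, x in M with m * x <> 0.  By minimality x = e * x for
    some e in M, and e * e - e annihilates x, which no nonzero element of M does,
    because the elements of M annihilating x form a left ideal smaller than M. *)
Lemma brauer M : minimal_left_ideal M ->
  exists2 e, M e & minimal_idempotent e.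
Proof.
move=> Mmin; have [m [x [Mm Mx mx0]]] := minimal_left_ideal_square Mmin.
have [[[M0 Mlin] MM] _ Mmn] := Mmin.
have [c xE] := minimal_generator Mmin (MM m x Mx) mx0 Mx.
pose e := c * m; have Me : M e by exact: MM.
have ex : e * x = x by rewrite /e -mulrA -xE.
pose Z : set A := [set z | M z /\ z * x = 0].
have lM : left_ideal M by case: Mmin.
have lZ : left_ideal Z.
  apply: left_idealI => [|z t [Mz z0] [Mt t0]|a z [Mz z0]].
  - by split; rewrite ?mul0r.
  - by split; [exact: left_idealD|rewrite mulrDl z0 t0 addr0].
  - by split; [exact: MM|rewrite -mulrA z0 mulr0].
have Z0 : Z = [set 0].
  case: (Mmn Z lZ) => [z []//|//|ZM].
  by have : M m by []; rewrite -ZM => -[_ /eqP]; rewrite (negbTE mx0).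
have ee : e * e = e.
  have : Z (e * e - e).
    split; last by rewrite mulrBl -mulrA !ex subrr.
    apply: left_idealD => //; first exact: MM.
    by rewrite -mulN1r; exact: MM.
  by rewrite Z0 => /eqP; rewrite subr_eq0 => /eqP.
exists e => //; split=> // [|u ue u0].
  by apply: contra_neq mx0 => e0; rewrite -ex e0 mul0r mulr0.
have Mu : M u by rewrite -ue; exact: MM.
by have [b ->] := minimal_generator Mmin Mu u0 Me; exists b.
Qed.

Hypothesis minA : forall I, left_ideal I -> I <> [set 0] ->
  exists2 M, minimal_left_ideal M & M `<=` I.

(** The left annihilator of p contains a minimal left ideal, generated by an
    idempotent e with e * p = 0.  Replacing e by (1 - p) * e makes the other
    product vanish too. *)
Lemma complement_idempotent p : p * p = p -> p != 1 ->
  exists f, [/\ minimal_idempotent f /\ socle A f, f * f = f,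
    p * f = 0 & f * p = 0].
Proof.
move=> pp p1; pose I : set A := [set x | x * p = 0].
have lI : left_ideal I.
  apply: left_idealI => [|x y x0 y0|a x x0]; rewrite /I /=.
  - by rewrite mul0r.
  - by rewrite mulrDl x0 y0 addr0.
  - by rewrite -mulrA x0 mulr0.
have In0 : I <> [set 0].
  move=> I0; have : I (1 - p) by rewrite /I /= mulrBl mul1r pp subrr.
  by rewrite I0 => /eqP; rewrite subr_eq0 eq_sym (negbTE p1).
have [M Mmin MI] := minA lI In0.
have [e Me [ee e0 emin]] := brauer Mmin.
have ep : e * p = 0 by exact: MI.
have Mlid : left_ideal M by case: Mmin.
pose f := (1 - p) * e.
have ef : e * f = e by rewrite /f mulrA mulrBr mulr1 ep subr0.
have fe : f * e = f by rewrite /f -mulrA ee.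
have ff : f * f = f by rewrite {1}/f -mulrA ef.
have pf : p * f = 0 by rewrite /f mulrA mulrBr mulr1 pp subrr mul0r.
have fp : f * p = 0 by rewrite /f -mulrA ep mulr0.
exists f; split=> //; split; last first.
  by apply: minimal_sub_socle Mmin _ _; case: Mlid => _; exact.
split=> // [|u uf u0].
  by apply: contra_neq e0 => f0; rewrite -ef f0 mulr0.
have ue : u * e = u by rewrite -uf -mulrA fe.
have [b bu] := emin u ue u0.
by exists ((1 - p) * b); rewrite -mulrA bu.
Qed.

Hypothesis small_pow2 : forall eps : K, 0 < eps -> exists n, 2^-1 ^+ n < eps.
Hypothesis closedS : closed (socle A).

Lemma minimal_idempotent_decomposition : exists n (e : nat -> A),
  (forall i, (i < n)%N -> minimal_idempotent (e i)) /\ 1 = \sum_(i < n) e i.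
Proof.
have [[n [e [eP e1]]]|[e [oe eP]]] := idempotent_exhaustion complement_idempotent.
  by exists n, e; split=> // i /eP[].
exfalso; apply: (no_orthogonal_sequence small_pow2 closedS oe) => i.
  by have [[]] := eP i.
by have [] := eP i.
Qed.

End Semiprime.

(** A nonzero u in e A f is invertible between the two corners: v * u = f and
    u * v = e.  So x |-> v * x identifies e A f with a subspace of f A f, with
    left inverse multiplication by u. *)
Lemma minimal_idempotent_link (A : pzRingType) (e f u : A) :
  minimal_idempotent e -> minimal_idempotent f ->
  e * u = u -> u * f = u -> u != 0 ->
  exists v, f * v * e = v /\ forall x, e * x = x -> u * (v * x) = x.
Proof.
move=> [ee e0 emin] [ff f0 fmin] eu uf u0.
have [v0 v0u] := fmin u uf u0.
pose v := f * v0 * e.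
have vu : v * u = f by rewrite /v -!mulrA eu v0u.
exists v; split; first by rewrite /v !mulrA ff -!mulrA ee.
have uve : u * v * e = u * v by rewrite /v -!mulrA ee.
have uvuv : u * v * (u * v) = u * v by rewrite mulrA -(mulrA u v u) vu uf.
have uv0 : u * v != 0.
  by apply: contra_neq u0 => uv; rewrite -uf -vu mulrA uv mul0r.
have [b bE] := emin _ uve uv0.
have uvE : u * v = e.
  have : e * (u * v) = e by rewrite -{1}bE -mulrA uvuv.
  by rewrite mulrA eu.
by move=> x ex; rewrite mulrA uvE.
Qed.

(** * Corners at minimal idempotents *)

(** The corner e A e is made a real division algebra with unit e, the real scalars
    acting through the embedding emb of R in K; this treats real and complex
    algebras alike.  Its norm is the one of A read in R by means of re. *)
Section Corner.
Variables (R : realType) (K : numFieldType) (emb : {rmorphism R -> K}).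
Variables (A : banachAlgType K) (e : A) (He : minimal_idempotent e).

Record corner := Corner { cval : A; cvalP : e * cval * e == cval }.

HB.instance Definition _ := [isSub for cval].
HB.instance Definition _ := [Choice of corner by <:].

Let ee : e * e = e. Proof. by case: He. Qed.

Lemma corner_l (x : corner) : e * cval x = cval x.
Proof. by rewrite -(eqP (cvalP x)) !mulrA ee. Qed.

Lemma corner_r (x : corner) : cval x * e = cval x.
Proof. by rewrite -(eqP (cvalP x)) -!mulrA ee. Qed.

Fact corner_mem0 : e * 0 * e == 0. Proof. by rewrite mulr0 mul0r. Qed.
Fact corner_memN (x : corner) : e * - cval x * e == - cval x.
Proof. by rewrite mulrN mulNr corner_l corner_r. Qed.
Fact corner_memD (x y : corner) :
  e * (cval x + cval y) * e == cval x + cval y.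
Proof. by rewrite mulrDr mulrDl !corner_l !corner_r. Qed.
Fact corner_mem1 : e * e * e == e. Proof. by rewrite !ee. Qed.
Fact corner_memM (x y : corner) :
  e * (cval x * cval y) * e == cval x * cval y.
Proof. by rewrite mulrA corner_l -mulrA corner_r. Qed.
Fact corner_memZ (r : R) (x : corner) :
  e * (emb r *: cval x) * e == emb r *: cval x.
Proof. by rewrite -banach_scalerAr -banach_scalerAl corner_l corner_r. Qed.

Definition corner_zero := Corner corner_mem0.
Definition corner_opp x := Corner (corner_memN x).
Definition corner_add x y := Corner (corner_memD x y).
Definition corner_one := Corner corner_mem1.
Definition corner_mul x y := Corner (corner_memM x y).
Definition corner_scale r x := Corner (corner_memZ r x).

Lemma cval_inj : injective cval. Proof. exact: val_inj. Qed.

Fact corner_addA : associative corner_add.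
Proof. by move=> x y z; apply: cval_inj; exact: addrA. Qed.
Fact corner_addC : commutative corner_add.
Proof. by move=> x y; apply: cval_inj; exact: addrC. Qed.
Fact corner_add0 : left_id corner_zero corner_add.
Proof. by move=> x; apply: cval_inj; exact: add0r. Qed.
Fact corner_addN : left_inverse corner_zero corner_opp corner_add.
Proof. by move=> x; apply: cval_inj; exact: addNr. Qed.

HB.instance Definition _ := GRing.isZmodule.Build corner
  corner_addA corner_addC corner_add0 corner_addN.

Fact corner_mulA : associative corner_mul.
Proof. by move=> x y z; apply: cval_inj; exact: mulrA. Qed.
Fact corner_mul1 : left_id corner_one corner_mul.
Proof. by move=> x; apply: cval_inj; exact: corner_l. Qed.
Fact corner_mulr1 : right_id corner_one corner_mul.
Proof. by move=> x; apply: cval_inj; exact: corner_r. Qed.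
Fact corner_mulDl : left_distributive corner_mul +%R.
Proof. by move=> x y z; apply: cval_inj; exact: mulrDl. Qed.
Fact corner_mulDr : right_distributive corner_mul +%R.
Proof. by move=> x y z; apply: cval_inj; exact: mulrDr. Qed.
Fact corner_1neq0 : corner_one != 0.
Proof. by have [_ e0 _] := He; apply: contra_neq e0 => /(congr1 cval). Qed.

HB.instance Definition _ := GRing.Zmodule_isNzRing.Build corner
  corner_mulA corner_mul1 corner_mulr1 corner_mulDl corner_mulDr corner_1neq0.

Fact corner_scaleA r s x :
  corner_scale r (corner_scale s x) = corner_scale (r * s) x.
Proof. by apply: cval_inj; rewrite /= scalerA rmorphM. Qed.
Fact corner_scale1 : left_id 1 corner_scale.
Proof. by move=> x; apply: cval_inj; rewrite /= rmorph1 scale1r. Qed.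
Fact corner_scaleDr : right_distributive corner_scale +%R.
Proof. by move=> r x y; apply: cval_inj; exact: scalerDr. Qed.
Fact corner_scaleDl x : {morph corner_scale^~ x : r s / r + s}.
Proof. by move=> r s; apply: cval_inj; rewrite /= rmorphD scalerDl. Qed.

HB.instance Definition _ := GRing.Zmodule_isLmodule.Build R corner
  corner_scaleA corner_scale1 corner_scaleDr corner_scaleDl.

Fact corner_scaleAl (r : R) (x y : corner) : r *: (x * y) = r *: x * y.
Proof. by apply: cval_inj; exact: banach_scalerAl. Qed.
Fact corner_scaleAr (r : R) (x y : corner) : r *: (x * y) = x * (r *: y).
Proof. by apply: cval_inj; exact: banach_scalerAr. Qed.

HB.instance Definition _ :=
  GRing.Lmodule_isLalgebra.Build R corner corner_scaleAl.
HB.instance Definition _ :=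
  GRing.Lalgebra_isAlgebra.Build R corner corner_scaleAr.

Lemma corner_left_inverse (x : corner) : x != 0 -> exists y : corner, y * x = 1.
Proof.
move=> x0; have [_ _ emin] := He.
have cx0 : cval x != 0 by apply: contra_neq x0 => cx; apply: cval_inj.
have [b bx] := emin _ (corner_r x) cx0.
have mb : e * (e * b * e) * e == e * b * e by rewrite !mulrA ee -!mulrA ee.
exists (Corner mb); apply: cval_inj => /=.
by rewrite -mulrA corner_l -mulrA bx ee.
Qed.

(** When every nonzero element has a left inverse, the left inverse y of x has a
    left inverse z, and z = x. *)
Lemma corner_inverse (x : corner) : x != 0 ->
  exists y : corner, y * x = 1 /\ x * y = 1.
Proof.
move=> x0; have [y yx] := corner_left_inverse x0; exists y; split=> //.
have y0 : y != 0.
  by apply: contra_neq (oner_neq0 corner) => y0; rewrite -yx y0 mul0r.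
have [z zy] := corner_left_inverse y0.
by rewrite -[in LHS](_ : z = x)// -[LHS]mulr1 -yx mulrA zy mul1r.
Qed.

Definition corner_inv (x : corner) : corner :=
  if pselect (x != 0) is left x0 then projT1 (cid (corner_inverse x0)) else x.
Definition corner_unit : pred corner := [pred x | x != 0].

Fact corner_mulVr : {in corner_unit, left_inverse 1 corner_inv *%R}.
Proof.
move=> x; rewrite inE /corner_inv; case: pselect => // x0 _.
by case: cid => y [].
Qed.
Fact corner_divrr : {in corner_unit, right_inverse 1 corner_inv *%R}.
Proof.
move=> x; rewrite inE /corner_inv; case: pselect => // x0 _.
by case: cid => y [].
Qed.
Fact corner_unitP (x y : corner) : y * x = 1 /\ x * y = 1 -> corner_unit x.
Proof.
move=> [yx _]; apply: contra_neq (oner_neq0 corner) => x0.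
by rewrite -yx x0 mulr0.
Qed.
Fact corner_inv_out : {in [predC corner_unit], corner_inv =1 id}.
Proof.
move=> x h; rewrite /corner_inv; case: pselect => // x0.
by move: h; rewrite !inE x0.
Qed.

HB.instance Definition _ := GRing.NzRing_hasMulInverse.Build corner
  corner_mulVr corner_divrr corner_unitP corner_inv_out.

Variable re : K -> R.
Hypothesis embK : forall k, 0 <= k -> emb (re k) = k.
Hypothesis emb_le : forall r s, (emb r <= emb s) = (r <= s).

Definition corner_norm (x : corner) : R := re `|cval x|.

Lemma corner_normE x : emb (corner_norm x) = `|cval x|.
Proof. exact: embK. Qed.

Lemma emb_norm r : `|emb r| = emb `|r|.
Proof.
have [r0|r0] := leP 0 r; first by rewrite !ger0_norm// -(rmorph0 emb) emb_le.
rewrite !ler0_norm ?rmorphN//; first exact: ltW.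
by rewrite -(rmorph0 emb) emb_le ltW.
Qed.

(** A spanning family over the reals is a fortiori one over K. *)
Theorem corner_span : exists b : 'I_4 -> A,
  forall x, e * x * e = x -> exists k : 'I_4 -> K, x = \sum_i k i *: b i.
Proof.
have N0 x : 0 <= corner_norm x.
  by rewrite -emb_le rmorph0 corner_normE.
have ND x y : corner_norm (x + y) <= corner_norm x + corner_norm y.
  by rewrite -emb_le rmorphD !corner_normE; exact: ler_normD.
have NZ r x : corner_norm (r *: x) = `|r| * corner_norm x.
  apply: (fmorph_inj emb); rewrite rmorphM !corner_normE -emb_norm.
  exact: normrZ.
have NM x y : corner_norm (x * y) <= corner_norm x * corner_norm y.
  by rewrite -emb_le rmorphM !corner_normE; exact: banach_normM.
have N1 : 1 <= corner_norm 1.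
  have c1 : 0 < corner_norm 1.
    rewrite lt0r N0 andbT; apply/eqP => c0; have [_ /eqP e0 _] := He; apply: e0.
    by apply/eqP; rewrite -normr_eq0 -(corner_normE 1) c0 rmorph0.
  by have := NM 1 1; rewrite mulr1 ler_pMr.
have divC (x : corner) : x != 0 -> x \is a GRing.unit by [].
have [b Hb] := frobenius_span4 divC (real_quadratic N0 ND NZ NM N1 divC).
exists (fun i => cval (b i)) => x /eqP ex.
have [k kE] := Hb (Corner ex); exists (fun i => emb (k i)).
rewrite -[LHS]/(cval (Corner ex)) kE.
by elim/big_ind2: _ => // u v u' v' <- <-.
Qed.

End Corner.

(** * Finite dimensionality *)

Section Final.
Variables (R : realType) (K : numFieldType) (emb : {rmorphism R -> K}).
Variable re : K -> R.
Hypothesis embK : forall k, 0 <= k -> emb (re k) = k.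
Hypothesis emb_le : forall r s, (emb r <= emb s) = (r <= s).
Variable A : banachAlgType K.

Lemma small_pow2 (eps : K) : 0 < eps -> exists n, 2^-1 ^+ n < eps.
Proof.
move=> eps0; have eE := embK (ltW eps0).
have emb_lt r s : (emb r < emb s) = (r < s).
  by rewrite !lt_neqAle emb_le (inj_eq (fmorph_inj emb)).
have r0 : 0 < re eps by rewrite -emb_lt rmorph0 eE.
exists (Num.truncn (re eps)^-1).+1; rewrite -[ltRHS]eE.
have -> : 2^-1 = emb 2^-1 by rewrite fmorphV rmorph_nat.
rewrite -rmorphXn emb_lt exprVn invf_plt ?posrE ?exprn_gt0//.
rewrite (lt_le_trans (truncnS_gt _))// -natrX ler_nat.
exact/ltnW/ltn_expl.
Qed.

Lemma two_corner_span (e f : A) : minimal_idempotent e -> minimal_idempotent f ->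
  exists b : 'I_4 -> A, forall x, e * x = x -> x * f = x ->
    exists k : 'I_4 -> K, x = \sum_i k i *: b i.
Proof.
move=> He Hf.
have [[u [eu uf u0]]|none] := pselect
    (exists u, [/\ e * u = u, u * f = u & u != 0]); last first.
  exists (fun=> 0) => x ex xf; exists (fun=> 0).
  rewrite big1 => [|i _]; last by rewrite scaler0.
  by apply/eqP; apply: contrapT => /negP x0; apply: none; exists x.
have [v [fve uvK]] := minimal_idempotent_link He Hf eu uf u0.
have [b bP] := corner_span Hf embK emb_le.
have [ff _ _] := Hf.
exists (fun i => u * b i) => x ex xf.
have [k kE] : exists k : 'I_4 -> K, v * x = \sum_i k i *: b i.
  have fv : f * v = v by rewrite -fve !mulrA ff.
  by apply: bP; rewrite !mulrA fv -mulrA xf.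
exists k; rewrite -[LHS](uvK x ex) kE mulr_sumr.
by apply: eq_bigr => i _; rewrite banach_scalerAr.
Qed.

(** Write 1 as a finite sum of minimal idempotents e i; then x is the sum of the
    e i * x * e j, each in the span of four vectors. *)
Theorem closed_socle_finite_dimensional :
  semiprime A -> closed (socle A) ->
  (forall I : set A, left_ideal I -> I <> [set 0] ->
     exists2 M : set A, minimal_left_ideal M & M `<=` I) ->
  finite_dimensional A.
Proof.
move=> sA cS minA.
have [n [e [eP e1]]] := minimal_idempotent_decomposition sA minA small_pow2 cS.
have /choice[b bP] : forall ij : 'I_n * 'I_n, exists b : 'I_4 -> A,
    forall x, e ij.1 * x = x -> x * e ij.2 = x ->
    exists k : 'I_4 -> K, x = \sum_i k i *: b i.
  by move=> [i j]; apply: two_corner_span; exact: eP.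
apply: (@spans_vector_axiom K A _
  (fun t : ('I_n * 'I_n) * 'I_4 => b t.1 t.2)) => x.
have /choice[k kP] : forall ij : 'I_n * 'I_n, exists k : 'I_4 -> K,
    e ij.1 * x * e ij.2 = \sum_l k l *: b ij l.
  move=> [i j]; apply: bP => /=.
    by have [ee _ _] := eP i (ltn_ord i); rewrite !mulrA ee.
  by have [ee _ _] := eP j (ltn_ord j); rewrite -!mulrA ee.
exists (fun t => k t.1 t.2).
rewrite -(pair_bigA _ (fun ij l => k ij l *: b ij l))/=.
rewrite -(eq_bigr _ (fun ij _ => kP ij)).
rewrite -(pair_bigA _ (fun i j : 'I_n => e i * x * e j))/=.
rewrite -[LHS]mul1r -[LHS]mulr1 e1 mulr_suml mulr_suml.
by apply: eq_bigr => i _; rewrite mulr_sumr.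
Qed.

End Final.

(* The scalar field is either the reals or the complex numbers. *)
Theorem theorem3 (R : realType) :
  (forall A : banachAlgType R,
     semiprime A ->
     closed (socle A) ->
     (forall I : set A, left_ideal I -> I <> [set 0] ->
        exists2 M : set A, minimal_left_ideal M & M `<=` I) ->
     finite_dimensional A) /\
  (forall A : banachAlgType R[i],
     semiprime A ->
     closed (socle A) ->
     (forall I : set A, left_ideal I -> I <> [set 0] ->
        exists2 M : set A, minimal_left_ideal M & M `<=` I) ->
     finite_dimensional A).
Proof.
split=> A.
  by apply: (@closed_socle_finite_dimensional R R idfun id).
apply: (@closed_socle_finite_dimensional R R[i] (real_complex R) (@complex.Re R)).
  by move=> [a b]; rewrite lecE /= => /andP[/eqP -> _].
by move=> r s; rewrite lecR.
Qed.
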